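(* Let $n\ge 3$ be an integer, $\eta>0$, and let $\alpha,\beta\in\mathbb{R}$ be constants such that $\beta>0$ or $\alpha=0$. For $0<m\le\frac{n-2}{n}$ let $v^{(m)}$ be the radially symmetric solution of $$\frac{n-1}{m}\Delta v^m+\alpha v+\beta x\cdot\nabla v=0,\quad v>0,\quad\text{in }\mathbb{R}^n,\qquad v(0)=\eta.$$ Then, as $m\to 0$, $v^{(m)}$ converges uniformly on every compact subset of $\mathbb{R}^n$ to the radially symmetric solution $u$ of $$(n-1)\Delta\log u+\alpha u+\beta x\cdot\nabla u=0,\quad u>0,\quad\text{in }\mathbb{R}^n,\qquad u(0)=\eta.$$
   Context: Solutions are classical positive solutions on $\mathbb{R}^n$; radially symmetric means depending only on $|x|$. With $n,\eta,\alpha,\beta$ fixed, the radially symmetric solution $v^{(m)}$ exists and is unique for all sufficiently small $m>0$ (if $\beta>0$, whenever $m\alpha\le\beta(n-2)$; if $\alpha=0$ it is the constant $\eta$), so the limit $m\to0$ makes sense. The radially symmetric solution $u$ of the limiting problem also exists and is unique. *)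

(* Defs.v *)
From HB Require Import structures.
From mathcomp Require Import all_boot all_order all_algebra.
From mathcomp Require Import all_classical all_reals all_analysis.

Set Implicit Arguments.
Unset Strict Implicit.
Unset Printing Implicit Defensive.

Import Order.TTheory GRing.Theory Num.Theory.
Import numFieldNormedType.Exports.

Local Open Scope classical_set_scope.
Local Open Scope ring_scope.

Section PDE.
Variables (R : realType) (n : nat).
Implicit Types (f v u : 'rV[R]_n -> R) (x y : 'rV[R]_n).

Definition partial (i : 'I_n) f : 'rV[R]_n -> R := 'D_(delta_mx 0 i) f.

Definition laplacian f x : R := \sum_(i < n) partial i (partial i f) x.

(* x . grad f (x) *)
Definition euler_derivative f x : R := \sum_(i < n) x 0 i * partial i f x.

(* ['D_v f] is total, so existence of the partial derivatives is required
   separately from their continuity. *)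
Definition is_C1 f : Prop :=
  continuous f /\
  forall i : 'I_n, (forall x, derivable f x (delta_mx 0 i)) /\
                   continuous (partial i f).

Definition is_C2 f : Prop := is_C1 f /\ forall i : 'I_n, is_C1 (partial i f).

(* The library norm on ['rV[R]_n] is the sup norm; radial symmetry is with
   respect to the Euclidean one. *)
Definition euclidean_norm x : R := Num.sqrt (\sum_(i < n) x 0 i ^+ 2).

Definition radially_symmetric f : Prop :=
  forall x y, euclidean_norm x = euclidean_norm y -> f x = f y.

Definition fast_diffusion_solution (alpha beta eta m : R) v : Prop :=
  [/\ is_C2 v,
      forall x, 0 < v x,
      forall x, (n%:R - 1) / m * laplacian (fun y => v y `^ m) x
                + alpha * v x + beta * euler_derivative v x = 0
    & v 0 = eta].

Definition log_diffusion_solution (alpha beta eta : R) u : Prop :=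
  [/\ is_C2 u,
      forall x, 0 < u x,
      forall x, (n%:R - 1) * laplacian (fun y => ln (u y)) x
                + alpha * u x + beta * euler_derivative u x = 0
    & u 0 = eta].

End PDE.

(* Main.v *)
Require Import Defs.
From mathcomp Require Import all_boot all_order all_algebra.
From mathcomp Require Import all_classical all_reals all_analysis.
From mathcomp Require Import ring lra.
Import Order.TTheory GRing.Theory Num.Theory.
Import numFieldNormedType.Exports.
Local Open Scope classical_set_scope.
Local Open Scope ring_scope.

(** Radial symmetry turns both equations into one family of ordinary
differential equations indexed by [m >= 0].  Write a radial solution as [exp l]
along a half-axis and put [Q = exp (m l) l'].  Since [Q] is the derivative of
[exp (m l) / m] when [m > 0] and of [l] when [m = 0], the two equations become,
for [r > 0],
   [(n-1) (Q' + (n-1)/r Q) + alpha exp l + beta r exp l l' = 0],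
so that the limit problem is the member [m = 0] of the family
([log_profile_of_solution]), and the theorem is a statement of continuous
dependence on [m] for an initial value problem that is singular at [r = 0].

The singularity is removed by multiplying by [r^(n-1)]:
   [((n-1) r^(n-1) Q + beta r^n exp l)' = (beta n - alpha) r^(n-1) exp l].
The bracket vanishes at [0], hence two solutions satisfy
   [|Q - Q~| <= C r sup_[0,r] |exp l - exp l~|]
with [C] independent of [m] ([log_flux_dist_le]).

Let [u = exp lu] solve the limit problem and [v = exp lv] the problem with
parameter [m]; both equal [eta] at [0].  The difference [g = lv - lu] satisfies
   [g' = exp (- m lv) (Q_v - Q_u) + (exp (- m lv) - 1) lu'].
On a bounded interval [[0, X]] the functions [lu] and [lu'] are bounded, and as
long as [|g| <= 1] so is [lv]; the right-hand side is then at most a constant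
times [sup |g| + m].  Comparing [g] with the barrier [m exp (K r)] for [K] large
([barrier]) gives [|g| <= m exp (K X)] on [[0, X]] as soon as this bound is
itself at most [1], which justifies the assumption [|g| <= 1] along the way.
Thus [|v - u| = O(m)] uniformly on balls ([log_profile_dist_le]).  No a priori
estimate on [v] is needed: the bounds on the fixed function [u] suffice. *)

(** * A barrier argument on the half-line *)

Lemma abs_expR_sub1_le {R : realType} (x : R) :
  `|x| <= 1 -> `|expR x - 1| <= expR 1 * `|x|.
Proof.
move=> x1.
have e1 := expR_ge1Dx x; have e2 := expR_ge1Dx (- x).
have ex : expR x * expR (- x) = 1 by rewrite -expRD subrr expR0.
have x0 := expR_gt0 x.
have le1 : expR x <= expR 1 by rewrite ler_expR (le_trans (ler_norm x)).
have le0 : 1 <= expR 1 :> R by rewrite -expR0 ler_expR.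
case: (lerP 0 x) => hx.
  rewrite (ger0_norm hx) ger0_norm; nra.
rewrite (ltr0_norm hx) ltr0_norm; nra.
Qed.

Lemma is_derive_continuous {R : realType} {f df : R -> R} :
  (forall r : R, is_derive r 1 f (df r)) -> continuous f.
Proof.
by move=> hf r; apply/differentiable_continuous/derivable1_diffP; case: (hf r).
Qed.

(** A first-failure argument: at the least [c] with [|g c| >= E c], the
hypothesis holds on all of [(0, c)], so [E + g] and [E - g] increase there from
positive values at [0] and are still positive at [c].  The estimate on [dg] may
thus use the bound on [g] that is being proved. *)
Lemma barrier {R : realType} (g dg E dE : R -> R) (X : R) :
  (forall r : R, is_derive r 1 g (dg r)) ->
  (forall r : R, is_derive r 1 E (dE r)) ->
  `|g 0| < E 0 ->
  (forall r, 0 < r <= X -> (forall s, 0 <= s <= r -> `|g s| <= E s) ->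
     `|dg r| < dE r) ->
  forall r : R, 0 <= r <= X -> `|g r| <= E r.
Proof.
move=> hg hE h0 H.
have cg := is_derive_continuous hg; have cE := is_derive_continuous hE.
move=> x /andP[x0 xX]; rewrite leNgt; apply/negP => bad.
pose S := `[0, x]%classic `&` [set r | 0 <= `|g r| - E r].
have cS : compact S.
  apply: compact_closedI; first exact: segment_compact.
  apply: (@preimage_closed _ _ (fun r => `|g r| - E r) [set t | 0 <= t]).
    move=> r _; apply: cvgB; last exact: cE.
    by apply: cvg_norm; exact: cg.
  exact: closed_ge.
have S0 : S !=set0.
  by exists x; split; rewrite /= ?in_itv/= ?x0 ?lexx ?subr_ge0 ?ltW.
have cid : {within S, continuous (@id R)}.
  by apply: continuous_subspaceT => r; exact: cvg_id.
have [c] := compact_EVT_min S0 cS cid.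
rewrite inE => -[] /=; rewrite in_itv/= subr_ge0 => /andP[c0 cx] Ec cmin.
have cgt0 : 0 < c.
  rewrite lt_neqAle c0 andbT eq_sym; apply/eqP => ceq.
  by move: Ec; rewrite ceq leNgt h0.
have below s : 0 <= s -> s < c -> `|g s| <= E s.
  move=> s0 sc; rewrite leNgt; apply/negP => Hs.
  have /cmin : s \in S.
    rewrite inE; split; rewrite /= ?in_itv/= ?s0 ?subr_ge0 ?ltW//.
    exact: lt_le_trans sc cx.
  by rewrite leNgt sc.
(* Used with [sg = 1] and [sg = -1]. *)
have key (sg : R) : `|sg| <= 1 -> 0 < E c + sg * g c.
  move=> sg1.
  have hd (r : R) : is_derive r 1 (fun t => E t + sg * g t) (dE r + sg * dg r).
    by apply: is_deriveD.
  have [|d] := @MVT _ _ _ 0 c cgt0 (fun r _ => hd r).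
    exact/continuous_subspaceT/(is_derive_continuous hd).
  rewrite in_itv/= => /andP[d0 dc] eqd.
  have dX : 0 < d <= X by rewrite d0 ltW// (lt_le_trans dc)// (le_trans cx).
  have lt1 : `|dg d| < dE d.
    apply: H => // s /andP[s0 sd]; apply: below => //; exact: le_lt_trans sd dc.
  have aux (a b : R) : `|a| < b -> 0 < b + sg * a.
    move=> ab; have : `|sg * a| < b.
      by rewrite normrM (le_lt_trans _ ab)// ler_piMl.
    by rewrite ltr_norml; lra.
  have := aux _ _ lt1; have := aux _ _ h0; nra.
have k1 : 0 < E c + 1 * g c by apply: key; rewrite normr1.
have k2 : 0 < E c + (-1) * g c by apply: key; rewrite normrN normr1.
move: Ec; rewrite leNgt ltr_norml => /negP; apply; apply/andP; split; lra.
Qed.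

(** * The radial equation in logarithmic form *)

(** With [v = exp l], this is the radial component of [v^(m-1) grad v], that
is, of [grad (v^m) / m] for [m <> 0] and of [grad (log v)] for [m = 0]. *)
Definition log_flux {R : realType} (m : R) (l dl : R -> R) (r : R) : R :=
  expR (m * l r) * dl r.

(** The radial equation in dimension [n = j.+2], solved for the derivative of
the flux.  It is required only for [r > 0], where [1 / r] makes sense; the
behaviour at the origin is contained in the continuity of [dl] at [0]. *)
Definition log_profile {R : realType} (j : nat) (alpha beta m : R)
    (l dl : R -> R) : Prop :=
  [/\ forall r : R, is_derive r 1 l (dl r), continuous dl &
      forall r : R, 0 < r -> is_derive r 1 (log_flux m l dl)
        (- (j.+1%:R / r * log_flux m l dl r
            + (alpha * expR (l r) + beta * r * (expR (l r) * dl r))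
              / j.+1%:R))].

(** The factor [r^(n-1)] absorbs the singular term [(n-1)/r Q] and turns
[beta r exp l l'] into a total derivative up to a multiple of [exp l]: no
derivative of [l] is left on the right. *)
Lemma log_flux_identity {R : realType} (j : nat) (alpha beta m : R)
    (l dl : R -> R) (r : R) : log_profile j alpha beta m l dl -> 0 < r ->
  is_derive r 1 (fun t => j.+1%:R * (t ^+ j.+1 * log_flux m l dl t)
                          + beta * (t ^+ j.+2 * expR (l t)))
    ((beta * j.+2%:R - alpha) * (r ^+ j.+1 * expR (l r))).
Proof.
move=> [dl1 _ dF] r0.
have h1 := dl1 r; have h2 := dF r r0.
have h3 : is_derive r 1 (fun t => expR (l t)) (expR (l r) * dl r).
  exact: is_derive1_comp.
have hX k : is_derive r 1 (fun t : R => t ^+ k.+1) (k.+1%:R * r ^+ k).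
  apply: DeriveDef; first exact: exprn_derivable.
  by rewrite exp_derive scaler1.
have hX1 := hX j; have hX2 := hX j.+1.
apply: is_derive_eq.
rewrite /GRing.scale/= -[j.+2%:R]natr1 !exprS.
field.
by rewrite nat1r pnatr_eq0 (gt_eqF r0).
Qed.

Lemma continuous_log_flux {R : realType} (m : R) (l dl : R -> R) :
  continuous l -> continuous dl -> continuous (log_flux m l dl).
Proof.
move=> cl cdl r; apply: cvgM; last exact: cdl.
apply: (@continuous_comp _ _ _ (fun t => m * l t) expR);
  last exact: continuous_expR.
by apply: cvgM; [exact: cvg_cst|exact: cl].
Qed.

(** The quantity differentiated in [log_flux_identity] is zero at [0], so the
mean value theorem on [[0, r]] bounds the difference of two of them by
[r * r^(n-1) * S]; dividing by [r^(n-1)] leaves the factor [r].  The two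
parameters [m] and [m'] do not enter the identity, hence not the constant. *)
Lemma log_flux_dist_le {R : realType} {j : nat} {alpha beta m m' : R}
    {l dl l' dl' : R -> R} {r S : R} :
  log_profile j alpha beta m l dl -> log_profile j alpha beta m' l' dl' ->
  0 < r -> (forall s, 0 <= s <= r -> `|expR (l s) - expR (l' s)| <= S) ->
  `|log_flux m l dl r - log_flux m' l' dl' r|
    <= (`|beta * j.+2%:R - alpha| + `|beta|) * (r * S).
Proof.
move=> pl pl' r0 HS.
pose P m (l dl : R -> R) t := j.+1%:R * (t ^+ j.+1 * log_flux m l dl t)
                          + beta * (t ^+ j.+2 * expR (l t)).
have cP m1 l1 dl1 :
    log_profile j alpha beta m1 l1 dl1 -> continuous (P m1 l1 dl1).
  move=> [/is_derive_continuous cl cdl _] t.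
  apply: cvgD; apply: cvgM; try exact: cvg_cst;
   apply: cvgM; try exact: exprn_continuous.
    exact: continuous_log_flux.
  by apply: (@continuous_comp _ _ _ l1 expR);
    [exact: cl|exact: continuous_expR].
have [||c] := @MVT _ (fun t => P m l dl t - P m' l' dl' t)
  (fun t => (beta * j.+2%:R - alpha) * (t ^+ j.+1 * expR (l t))
    - (beta * j.+2%:R - alpha) * (t ^+ j.+1 * expR (l' t))) 0 r r0.
- move=> t; rewrite in_itv/= => /andP[t0 _].
  by apply: is_deriveB; exact: log_flux_identity.
- by apply: continuous_subspaceT => t; apply: cvgB; exact: cP.
rewrite in_itv/= => /andP[c0 cr].
rewrite /P !expr0n/= !(mul0r,mulr0,subr0,addr0).
set Q := log_flux m l dl r; set Q' := log_flux m' l' dl' r => eqn.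
have rj : 0 < r ^+ j.+1 by rewrite exprn_gt0.
have eqn2 : j.+1%:R * (r ^+ j.+1 * (Q - Q')) =
   (beta * j.+2%:R - alpha) * (c ^+ j.+1 * (expR (l c) - expR (l' c))) * r
   - beta * (r ^+ j.+1 * r * (expR (l r) - expR (l' r))).
  move: eqn; rewrite [r ^+ j.+2]exprSr; lra.
have Sr : `|expR (l r) - expR (l' r)| <= S by apply: HS; rewrite lexx ltW.
have Sc : `|expR (l c) - expR (l' c)| <= S by apply: HS; rewrite !ltW.
have cj : c ^+ j.+1 <= r ^+ j.+1 by rewrite lerXn2r ?nnegrE ?ltW.
have cj0 : 0 <= c ^+ j.+1 by rewrite exprn_ge0// ltW.
move: (c ^+ j.+1) (r ^+ j.+1) cj0 cj rj eqn2 => cJ rJ cj0 cj rj eqn2 {eqn}.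
rewrite -(ler_pM2l rj).
apply: (@le_trans _ _ `|j.+1%:R * (rJ * (Q - Q'))|).
  rewrite !normrM (gtr0_norm rj) normr_nat ler_peMl//.
    by rewrite mulr_ge0// ltW.
  by rewrite ler1n.
rewrite eqn2 (le_trans (ler_normB _ _))//.
move: (beta * j.+2%:R - alpha) => A; rewrite [leRHS]mulrCA mulrDl.
rewrite !normrM (gtr0_norm r0) (gtr0_norm rj) (ger0_norm cj0).
apply: lerD.
  have -> : `|A| * (rJ * (r * S)) =
    `|A| * (rJ * S) * r by ring.
  rewrite ler_pM2r// ler_wpM2l//; exact: ler_pM.
have -> : `|beta| * (rJ * (r * S)) = `|beta| * (rJ * r * S) by ring.
by rewrite ler_wpM2l// ler_wpM2l// mulr_ge0// ltW.
Qed.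

Lemma continuous_bounded_on_segment {R : realType} (f : R -> R) (X : R) :
  continuous f -> exists2 B, 0 <= B & forall r, 0 <= r <= X -> `|f r| <= B.
Proof.
move=> cf; have [X0|X0] := ltP X 0.
  by exists 0 => // r /andP[r0 /(le_trans r0)]; rewrite leNgt X0.
have cnf : {within `[0, X], continuous (fun t => `|f t|)}.
  by apply: continuous_subspaceT => r; apply: cvg_norm; exact: cf.
have [c _ cmax] := EVT_max X0 cnf.
by exists `|f c| => // r r0X; apply: cmax; rewrite in_itv.
Qed.

Lemma abs_expRB_le {R : realType} (x y : R) :
  `|x - y| <= 1 -> `|expR x - expR y| <= expR (y + 1) * `|x - y|.
Proof.
move=> h; have -> : expR x - expR y = expR y * (expR (x - y) - 1).
  by rewrite mulrBr -expRD mulr1 [y + _]addrC subrK.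
rewrite normrM (gtr0_norm (expR_gt0 _)) (expRD y) -mulrA.
by rewrite ler_pM2l ?expR_gt0// abs_expR_sub1_le.
Qed.

(** * Continuous dependence on the exponent *)

(** The constants [C] and [d] depend on the limit profile [lu] and on [X] only,
which makes the estimate uniform in [m]. *)
Lemma log_profile_dist_le {R : realType} (j : nat) (alpha beta X : R)
    (lu du : R -> R) :
  0 <= X -> log_profile j alpha beta 0 lu du ->
  exists C d : R, [/\ 0 < C, 0 < d & forall m lv dv, 0 < m <= d ->
    log_profile j alpha beta m lv dv -> lv 0 = lu 0 ->
    forall r, 0 <= r <= X -> `|expR (lv r) - expR (lu r)| <= C * m].
Proof.
move=> X0 pu; have [hlu cdu _] := pu.
have [B B0 HB] := continuous_bounded_on_segment lu X (is_derive_continuous hlu).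
have [D D0 HD] := continuous_bounded_on_segment du X cdu.
pose A := `|beta * j.+2%:R - alpha| + `|beta|.
have A0 : 0 <= A by rewrite addr_ge0.
(* The first two terms of [K] bound the coefficients of [E] coming from the
   difference of the fluxes and from the factor [expR (- m lv) - 1]; the final
   [1] makes the comparison of derivatives strict. *)
pose K := expR 1 * (A * (X * expR (B + 1))) + expR 1 * (B + 1) * D + 1.
have K0 : 0 < K.
  by rewrite ltr_wpDl// addr_ge0// !mulr_ge0 ?expR_ge0// addr_ge0.
(* The first bound keeps [m lv] at most [1], the second keeps the barrier at
   most [1] up to [X]. *)
pose d := Num.min (B + 1)^-1 (expR (- (K * X))).
have d0 : 0 < d by rewrite lt_min invr_gt0 expR_gt0 andbT ltr_wpDl.
exists (expR (B + 1) * expR (K * X)), d.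
split; [by rewrite mulr_gt0 ?expR_gt0|by []|].
move=> m lv dv /andP[m0]; rewrite le_min => /andP[mB mX] pv lv0.
have {}mB : m * (B + 1) <= 1 by rewrite -ler_pdivlMr ?mul1r// ltr_wpDl.
have [hlv cdv _] := pv.
pose E r := m * expR (K * r).
have E_ge_m r : 0 <= r -> m <= E r.
  move=> r0; rewrite -[leLHS]mulr1 ler_pM2l// -expR0 ler_expR.
  by rewrite mulr_ge0// ltW.
have E_mono r s : r <= s -> E r <= E s.
  by move=> rs; rewrite ler_pM2l// ler_expR ler_pM2l.
have EX1 : E X <= 1.
  by rewrite -(ler_pM2r (expR_gt0 (- (K * X)))) mul1r /E -mulrA -expRD
    subrr expR0 mulr1.
have main r : 0 <= r <= X -> `|lv r - lu r| <= E r.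
  apply: (@barrier R (fun r => lv r - lu r) (fun r => dv r - du r) E
    (fun r => K * E r)).
  - move=> s /=; rewrite /E.
    have hK : is_derive s 1 (fun t : R => K * t) K.
      by apply: is_derive_eq; rewrite /GRing.scale/= mulr1.
    have hE : is_derive s 1 (fun t : R => expR (K * t)) (expR (K * s) * K).
      exact: is_derive1_comp.
    by apply: is_derive_eq; rewrite /GRing.scale/=; ring.
  - by rewrite lv0 subrr normr0 /E mulr0 expR0 mulr1.
  move=> s /andP[s0 sX] gE.
  have sX' : 0 <= s <= X by rewrite ltW.
  have Es1 : E s <= 1 by rewrite (le_trans _ EX1)// E_mono.
  have close : forall t, 0 <= t <= s ->
      `|expR (lv t) - expR (lu t)| <= expR (B + 1) * E s.
    move=> t /[dup] tI /andP[t0 ts]; have gt := gE t tI.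
    have Et := E_mono _ _ ts.
    have tX : 0 <= t <= X by rewrite t0 (le_trans ts).
    apply: (le_trans (abs_expRB_le _ _ _)).
      by rewrite (le_trans gt)// (le_trans Et).
    apply: ler_pM; rewrite ?expR_ge0// ?(le_trans gt)// ler_expR lerD2r.
    by rewrite (le_trans (ler_norm _))// HB.
  have fl := log_flux_dist_le pv pu s0 close.
  (* As the limit flux is [du] itself, the equation for the difference splits
     into a flux difference and the defect of [expR (- m lv)] from [1]. *)
  have -> : dv s - du s = expR (- (m * lv s)) *
       (log_flux m lv dv s - log_flux 0 lu du s)
       + (expR (- (m * lv s)) - 1) * du s.
    rewrite /log_flux mul0r expR0 mul1r mulrBr mulrA -expRD addNr expR0; ring.
  have ml : `|m * lv s| <= m * (B + 1).
    rewrite normrM gtr0_norm// ler_pM2l// -(subrK (lu s) (lv s)).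
    rewrite (le_trans (ler_normD _ _))// addrC lerD ?HB//.
    by rewrite (le_trans (gE s _))// lexx ltW.
  have ml1 : `|- (m * lv s)| <= 1 by rewrite normrN (le_trans ml).
  apply: (@le_lt_trans _ _ ((K - 1) * E s)); last first.
    by rewrite ltr_pM2r ?gtrBl// mulr_gt0 ?expR_gt0.
  rewrite (le_trans (ler_normD _ _))// !normrM (gtr0_norm (expR_gt0 _)).
  rewrite /K addrK mulrDl lerD//.
    rewrite -!mulrA; apply: ler_pM; rewrite ?expR_ge0 ?normr_ge0//.
      by rewrite ler_expR (le_trans (ler_norm _)).
    apply: (le_trans fl); rewrite ler_wpM2l// ler_wpM2r//.
    by rewrite mulr_ge0 ?expR_ge0// (le_trans _ (E_ge_m _ (ltW s0)))// ltW.
  have := abs_expR_sub1_le _ ml1; rewrite normrN => h1.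
  apply: (@le_trans _ _ (expR 1 * (m * (B + 1)) * D)).
    apply: ler_pM => //; last exact: HD.
    by rewrite (le_trans h1)// ler_pM2l ?expR_gt0.
  have -> : expR 1 * (m * (B + 1)) * D = expR 1 * (B + 1) * D * m by ring.
  apply: ler_wpM2l; last exact/E_ge_m/ltW.
  by rewrite !mulr_ge0 ?expR_ge0// addr_ge0.
move=> r /[dup] rX /andP[r0 rX'].
have gr := main r rX; have Er := E_mono _ _ rX'.
apply: (le_trans (abs_expRB_le _ _ _)).
  by rewrite (le_trans gr)// (le_trans Er).
rewrite -mulrA; apply: ler_pM; rewrite ?expR_ge0//.
  by rewrite ler_expR lerD2r (le_trans (ler_norm _))// HB.
by rewrite (le_trans gr)// (le_trans Er)// /E mulrC.
Qed.

(** * Radial functions on the Euclidean space *)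

Lemma growth_rate_along_line {R : realType} {n} (f : 'rV[R]_n -> R)
    (x v : 'rV[R]_n) (s : R) :
  (fun h : R => h^-1 *: ((f \o shift (x + s *: v)) (h *: v) - f (x + s *: v)))
  = (fun h : R =>
       h^-1 *: (((fun t : R => f (x + t *: v)) \o shift s) (h *: (1 : R))
                - f (x + s *: v))).
Proof.
apply/funext => h /=; congr (_ *: (f _ - _)).
by rewrite [_ *: (1 : R)]mulr1 scalerDl addrCA.
Qed.

Lemma derivable_along_line {R : realType} {n} (f : 'rV[R]_n -> R)
    (x v : 'rV[R]_n) (s : R) :
  derivable f (x + s *: v) v = derivable (fun t : R => f (x + t *: v)) s 1.
Proof. by rewrite /derivable growth_rate_along_line. Qed.

Lemma derive_along_line {R : realType} {n} (f : 'rV[R]_n -> R)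
    (x v : 'rV[R]_n) (s : R) :
  'D_v f (x + s *: v) = 'D_1 (fun t : R => f (x + t *: v)) s.
Proof. by rewrite /derive growth_rate_along_line. Qed.

Lemma euclidean_norm_axis {R : realType} {n} (i0 i : 'I_n) (r h : R) :
  euclidean_norm (r *: delta_mx 0 i0 + h *: delta_mx 0 i) =
  if i == i0 then `|r + h| else Num.sqrt (r ^+ 2 + h ^+ 2).
Proof.
rewrite /euclidean_norm (bigD1 i0)//= !mxE !eqxx/= mulr1.
case: eqP => [->|/eqP ne].
  rewrite eqxx mulr1 big1 ?addr0 ?sqrtr_sqr// => k /negPf ki.
  by rewrite !mxE ki andbF !mulr0 addr0 expr0n.
rewrite eq_sym (negPf ne) (bigD1 i) 1?eq_sym//= !mxE !eqxx/= eq_sym (negPf ne).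
rewrite !mulr0 mulr1 addr0 add0r.
rewrite big1 ?addr0// => k /andP[/negPf k1 /negPf k2].
by rewrite !mxE k1 k2 !andbF !mulr0 addr0 expr0n.
Qed.

(** At a point of the axis [i0] at distance [r] from the origin, the pure second
derivatives are those of [h |-> W (r + h)] in the direction [i0], and of
[h |-> W (sqrt (r^2 + h^2))] in the [n] other directions; the latter has
derivative [h * (dW rho / rho)] with [rho = sqrt (r^2 + h^2)], whose derivative
at [h = 0] is [dW r / r]. *)
Lemma laplacian_radial {R : realType} {n} (w : 'rV[R]_n.+1 -> R) (W dW : R -> R)
    (i0 : 'I_n.+1) (r d2 : R) :
  (forall x, w x = W (euclidean_norm x)) ->
  (forall s : R, is_derive s 1 W (dW s)) -> 0 < r -> is_derive r 1 dW d2 ->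
  laplacian w (r *: delta_mx 0 i0) = d2 + n%:R / r * dW r.
Proof.
move=> wW hW r0 hdW; rewrite /laplacian (bigD1 i0)//=.
set e := delta_mx 0.
have line i : partial i (partial i w) (r *: e i0) =
    'D_1 (fun h : R =>
      'D_1 (fun k : R => W (euclidean_norm (r *: e i0 + k *: e i))) h) 0.
  have -> : (fun h : R =>
        'D_1 (fun k : R => W (euclidean_norm (r *: e i0 + k *: e i))) h)
      = (fun h : R => partial i w (r *: e i0 + h *: e i)).
    apply/funext => h; rewrite /partial derive_along_line.
    have -> // : (fun k : R => W (euclidean_norm (r *: e i0 + k *: e i)))
      = (fun k : R => w (r *: e i0 + k *: e i)).
    by apply/funext => k; rewrite wW.
  by rewrite -derive_along_line scale0r addr0.
congr (_ + _).
  rewrite line.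
  have near_r : \forall h \near (0 : R), 0 < r + h.
    have : (fun h : R => r + h) h @[h --> 0] --> r + 0.
      by apply: cvgD; [exact: cvg_cst|exact: cvg_id].
    by move=> /cvgr_gt; apply; rewrite addr0.
  have sh (k : R) : is_derive k 1 (fun h : R => r + h) 1.
    by apply: is_derive_eq; rewrite add0r mulr1.
  transitivity ('D_1 (fun h : R => dW (r + h)) 0).
    have H : \forall h \near (0 : R),
        'D_1 (fun k : R => W (euclidean_norm (r *: e i0 + k *: e i0))) h
        = dW (r + h).
      apply: filterS (near_join near_r) => h hh.
      have hW' : is_derive h 1 (fun k : R => W (r + k)) (dW (r + h)).
        by rewrite -[dW _]mulr1; exact: (is_derive1_comp (hW (r + h)) (sh h)).
      apply: derive_val; apply: (near_eq_is_derive _ hW').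
      by apply: filterS hh => k rk; rewrite euclidean_norm_axis eqxx gtr0_norm.
    exact: (near_eq_derive _ H).
  apply: derive_val; rewrite -[d2]mulr1; apply: is_derive1_comp.
  by rewrite addr0.
have other i : i != i0 -> partial i (partial i w) (r *: e i0) = dW r / r.
  move=> ne; rewrite line.
  pose rho (h : R) := Num.sqrt (r ^+ 2 + h ^+ 2).
  have rho_gt0 h : 0 < rho h.
    by rewrite sqrtr_gt0 ltr_wpDr ?sqr_ge0// exprn_gt0.
  have rho0 : rho 0 = r by rewrite /rho expr0n addr0 sqrtr_sqr gtr0_norm.
  have drho (h : R) : is_derive h 1 rho (h / rho h).
    have d1 : is_derive h 1 (fun h : R => r ^+ 2 + h ^+ 2) (2 * h).
      have hX : is_derive h 1 (fun t : R => t ^+ 2) (2 * h).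
        apply: DeriveDef; first exact: exprn_derivable.
        by rewrite exp_derive scaler1 expr1.
      by apply: is_derive_eq; rewrite add0r mul1r.
    have : is_derive h 1 rho ((2 * Num.sqrt (r ^+ 2 + h ^+ 2))^-1 * (2 * h)).
      apply: is_derive1_comp; apply: is_derive1_sqrt.
      by rewrite -sqrtr_gt0 rho_gt0.
    move=> h1; apply: is_derive_eq; rewrite -/(rho h).
    by field; rewrite gt_eqF.
  transitivity ('D_1 (fun h : R => dW (rho h) * (h / rho h)) 0).
    congr (derive _ _ _); apply/funext => h.
    have -> : (fun k : R => W (euclidean_norm (r *: e i0 + k *: e i)))
        = W \o rho.
      by apply/funext => k; rewrite euclidean_norm_axis (negPf ne).
    by case: (is_derive1_comp (hW (rho h)) (drho h)).
  apply: derive_val.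
  have h1 := drho 0.
  have h2 : is_derive (0 : R) 1 (fun h : R => dW (rho h))
      (d2 * (0 / rho 0)).
    by apply: is_derive1_comp; rewrite rho0.
  have h3 : is_derive (0 : R) 1 (fun h : R => (rho h)^-1)
      (- (rho 0)^-2 *: (0 / rho 0)).
    by apply: is_deriveV; rewrite gt_eqF.
  by apply: is_derive_eq; rewrite /GRing.scale/= rho0; ring.
rewrite (eq_bigr _ other) sumr_const cardC1 card_ord /=.
by rewrite -[LHS]mulr_natl mulrA mulrAC.
Qed.

Lemma euler_derivative_axis {R : realType} {n} (f : 'rV[R]_n -> R)
    (i0 : 'I_n) (r : R) :
  euler_derivative f (r *: delta_mx 0 i0) =
    r * partial i0 f (r *: delta_mx 0 i0).
Proof.
rewrite /euler_derivative (bigD1 i0)//= !mxE !eqxx mulr1.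
rewrite big1 ?addr0// => k /negPf ki.
by rewrite !mxE ki andbF mulr0 mul0r.
Qed.

Lemma radially_symmetric_axis {R : realType} {n} (f : 'rV[R]_n -> R)
    (i0 : 'I_n) x :
  radially_symmetric f -> f x = f (euclidean_norm x *: delta_mx 0 i0).
Proof.
move=> fr; apply: fr; have := euclidean_norm_axis i0 i0 (euclidean_norm x) 0.
rewrite eqxx scale0r !addr0 => ->.
by rewrite ger0_norm// sqrtr_ge0.
Qed.

(** * From the elliptic equations to the radial one *)

(** Both diffusions are treated at once: [phi] is the nonlinearity and the
hypothesis on [phi \o expR] says that [phi' s = c s^(m-1)].  It holds for
[phi s = s^m] with [c = m] and for [phi = ln] with [c = 1] and [m = 0]. *)
Lemma log_profile_of_solution {R : realType} (j : nat) (alpha beta c m : R)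
    (phi : R -> R) (v : 'rV[R]_j.+2 -> R) (i0 : 'I_j.+2) :
  c != 0 ->
  (forall l : R, is_derive l 1 (fun t => phi (expR t)) (c * expR (m * l))) ->
  is_C2 v -> (forall x, 0 < v x) -> radially_symmetric v ->
  (forall x, j.+1%:R / c * laplacian (fun y => phi (v y)) x
             + alpha * v x + beta * euler_derivative v x = 0) ->
  exists dl,
    log_profile j alpha beta m (fun r => ln (v (r *: delta_mx 0 i0))) dl.
Proof.
move=> c0 hphi [[_ C1] C2] v0 vr eqn.
set e := delta_mx 0 i0.
pose V (r : R) := v (r *: e); pose dV (r : R) := partial i0 v (r *: e).
pose ddV (r : R) := partial i0 (partial i0 v) (r *: e).
have axis (f : 'rV[R]_j.+2 -> R) (r : R) : derivable f (r *: e) e ->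
    is_derive r 1 (fun t : R => f (t *: e)) ('D_e f (r *: e)).
  have E : (fun t : R => f (t *: e)) = (fun t : R => f (0 + t *: e)).
    by apply/funext => t; rewrite add0r.
  rewrite -[r *: e]add0r derivable_along_line derive_along_line E => h.
  exact: derivableP.
have hV (r : R) : is_derive r 1 V (dV r) by apply: axis; exact: (C1 i0).1.
have hdV (r : R) : is_derive r 1 dV (ddV r).
  by apply: (axis (partial i0 v)); exact: ((C2 i0).2 i0).1.
have V0 r : 0 < V r by exact: v0.
pose l r := ln (V r); pose dl r := dV r / V r.
have hl (r : R) : is_derive r 1 l (dl r).
  by rewrite /dl mulrC; apply: is_derive1_comp; exact: is_derive1_ln.
have El r : expR (l r) = V r by rewrite lnK// posrE.
have hdl (r : R) : exists d, is_derive r 1 dl d.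
  have h1 := hdV r; have h2 := hV r.
  have h3 : is_derive r 1 (fun t : R => (V t)^-1) (- (V r)^-2 *: dV r).
    by apply: is_deriveV; rewrite gt_eqF.
  by eexists; apply: is_deriveM.
have hF (r : R) : exists d, is_derive r 1 (log_flux m l dl) d.
  have [d hd] := hdl r; have h1 := hl r.
  have h2 : is_derive r 1 (fun t : R => m * l t) (m * dl r).
    by apply: is_derive_eq.
  have h3 : is_derive r 1 (fun t : R => expR (m * l t))
      (expR (m * l r) * (m * dl r)).
    exact: is_derive1_comp.
  by eexists; apply: is_deriveM.
exists dl; split.
- exact: hl.
- by apply: is_derive_continuous => r; have [d [hd _]] := hdl r;
  exact: derivableP.
move=> r r0; have [d hd] := hF r.
have hW (s : R) : is_derive s 1 (fun t => phi (V t)) (c * log_flux m l dl s).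
  have -> : (fun t => phi (V t)) = (fun t => phi (expR t)) \o l.
    by apply/funext => t /=; rewrite El.
  rewrite /log_flux mulrA; exact: (is_derive1_comp (hphi (l s)) (hl s)).
have hdW : is_derive r 1 (fun s => c * log_flux m l dl s) (c * d).
  by apply: is_derive_eq.
have := eqn (r *: e).
rewrite (laplacian_radial _ _ _ i0 _ _ _ hW r0 hdW); last first.
  by move=> x; rewrite /V -radially_symmetric_axis.
rewrite euler_derivative_axis -/(V r) -/(dV r) -/(l r) El => eqr.
have -> : - (j.+1%:R / r * log_flux m l dl r
   + (alpha * V r + beta * r * (V r * dl r)) / j.+1%:R) = d; last by [].
have -> : V r * dl r = dV r by rewrite /dl mulrC divfK// gt_eqF.
have j0 : j.+1%:R != 0 :> R by rewrite pnatr_eq0.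
have eqd : j.+1%:R * (d + j.+1%:R / r * log_flux m l dl r) + alpha * V r
   + beta * (r * dV r) = 0.
  by rewrite -eqr; congr (_ + _ + _); field; rewrite c0 gt_eqF.
have ej : j.+1%:R * ((alpha * V r + beta * r * dV r) / j.+1%:R)
   = alpha * V r + beta * r * dV r by rewrite mulrC divfK.
apply: (mulfI j0); rewrite mulrN mulrDr ej.
move: eqd; rewrite mulrDr; lra.
Qed.

Lemma euclidean_norm_bounded {R : realType} {n} (K : set 'rV[R]_n) :
  compact K -> exists2 X, 0 <= X & forall x, K x -> euclidean_norm x <= X.
Proof.
move=> /compact_bounded[M [_ HM]]; pose B := `|M| + 1.
have B0 : 0 <= B by rewrite addr_ge0.
have HB x : K x -> `|x| <= B.
  by apply: HM; rewrite ltr_pwDr// ler_norm.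
exists (Num.sqrt (n%:R * B ^+ 2)); first exact: sqrtr_ge0.
move=> x Kx; rewrite ler_sqrt ?mulr_ge0 ?exprn_ge0//.
have -> : n%:R * B ^+ 2 = \sum_(i < n) B ^+ 2.
  by rewrite sumr_const card_ord mulr_natl.
apply: ler_sum => i _; rewrite -real_normK ?num_real// lerXn2r ?nnegrE//.
apply: le_trans (HB x Kx); rewrite [leRHS]/Num.norm/= mx_normrE.
exact: (le_bigmax _ (fun ij => `|x ij.1 ij.2|) (0, i)).
Qed.

(** * Convergence *)

Theorem theorem1p3 (R : realType) (n : nat) (eta alpha beta : R)
    (v : R -> 'rV[R]_n -> R) (u : 'rV[R]_n -> R) (m0 : R)
    (hn : (3 <= n)%N) (heta : 0 < eta) (hab : 0 < beta \/ alpha = 0)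
    (hm0 : 0 < m0 <= (n%:R - 2) / n%:R)
    (hv : forall m : R, 0 < m <= m0 ->
       fast_diffusion_solution alpha beta eta m (v m)
       /\ radially_symmetric (v m))
    (hu : log_diffusion_solution alpha beta eta u /\ radially_symmetric u) :
  forall K : set 'rV[R]_n, compact K -> {uniform K, v @ 0^'+ --> u}.
Proof.
move=> K cK; case: n hn v u hm0 hv hu K cK => [//|[//|j]] _ v u /andP[m0_gt0 _].
move=> hv [[uC2 u0 equ ueta] ur] K cK.
have pred_n : j.+2%:R - 1 = j.+1%:R :> R by rewrite -natr1 addrK.
have [X X0 HX] := euclidean_norm_bounded K cK.
pose i0 : 'I_j.+2 := ord0; pose e : 'rV[R]_j.+2 := delta_mx 0 i0.
have [du pu] : exists du,
    log_profile j alpha beta 0 (fun r => ln (u (r *: e))) du.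
  apply: (@log_profile_of_solution R j alpha beta 1 0 (@ln R) u i0) => //.
  - move=> l; rewrite mul0r expR0 mulr1.
    have -> : (fun t => ln (expR t)) = @id R.
      by apply/funext => t; rewrite expRK.
    exact: is_derive_id.
  - by move=> x; rewrite divr1 -pred_n.
have [C [d [C0 d0 HC]]] := log_profile_dist_le j alpha beta X _ _ X0 pu.
have close m x : 0 < m -> m <= m0 -> m <= d -> K x -> `|u x - v m x| <= C * m.
  move=> mgt0 mm0 md Kx.
  have [|[vC2 vp eqv veta] vr] := hv m; first by rewrite mgt0.
  have [dv pv] : exists dv,
      log_profile j alpha beta m (fun r => ln (v m (r *: e))) dv.
    apply: (@log_profile_of_solution R j alpha beta m m (fun s => s `^ m)
      (v m) i0) => //.
    - by rewrite gt_eqF.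
    - move=> l.
      have -> : (fun t => expR t `^ m) = (fun t => expR (m * t)).
        by apply/funext => t; rewrite mulrC expRM.
      have hml : is_derive l 1 (fun t : R => m * t) m.
        by apply: is_derive_eq; rewrite /GRing.scale/= mulr1.
      rewrite mulrC; exact: is_derive1_comp.
    - by move=> x'; rewrite -pred_n.
  rewrite (radially_symmetric_axis u i0)// (radially_symmetric_axis (v m) i0)//.
  rewrite -[X in `|X - _|]lnK ?posrE// -[X in `|_ - X|]lnK ?posrE// distrC.
  apply: HC pv _ _ _; first by rewrite mgt0.
    by rewrite !scale0r veta ueta.
  by rewrite sqrtr_ge0 HX.
have step P : nbhs (u : {uniform` K -> R}) P -> \forall m \near 0^'+, P (v m).
  move=> /uniform_nbhs[E [entE subP]].
  have [eps /= eps0 ballE] : filter_from [set x : R | 0 < x]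
      (fun e : R => [set xy : R * R | ball xy.1 e xy.2]) E.
    by rewrite entourage_from_ballE.
  have near_eps : \forall m \near 0^'+, m <= eps / (2 * C).
    by apply: nbhs_right_le; rewrite divr_gt0// mulr_gt0.
  near=> m; apply: subP => x Kx; apply: ballE => /=.
  have mgt0 : 0 < m by near: m; exact: nbhs_right_gt.
  apply: (@le_lt_trans _ _ (C * m)).
    by apply: close => //; near: m; exact: nbhs_right_le.
  have : m <= eps / (2 * C) by near: m.
  rewrite ler_pdivlMr ?mulr_gt0//; nra.
exact: step.
Unshelve. all: by end_near. Qed.
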